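(* Let $p$ be a prime, let $\zeta=e^{2\pi i/p}$, and let $(c_{ij})_{i,j\ge 1}$ be a skew-symmetric infinite matrix over the field $\mathbb{Z}_p$ such that the bilinear form $\omega:\Gamma\times\Gamma\to\mathbb{Z}_p$, $\omega(x,y)=\sum_{i,j=1}^\infty c_{ij}x_jy_i$, has infinite rank. Let $U_1,U_2,\dots$ be an irreducible sequence of unitary operators on a Hilbert space satisfying $U_k^p=\mathbf 1$ for all $k$ and $U_iU_j=\zeta^{c_{ij}}U_jU_i$ for all $i,j=1,2,\dots$. Then $C^*(U_1,U_2,\dots)$ is a UHF algebra of type $p^\infty$ (so, for $p=2$, the $C^*$-algebra generated by an irreducible spin system whose commutation matrix has infinite rank is the CAR algebra, an infinite tensor product of copies of $M_2(\mathbb C)$).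
   Context: $\mathbb{Z}_p=\{0,1,\dots,p-1\}$ is the field with $p$ elements. A matrix $(c_{ij})$ over $\mathbb{Z}_p$ is skew-symmetric if $c_{ij}=-c_{ji}$ and $c_{ii}=0$ for all $i,j$ (the latter is automatic for $p$ odd). $\Gamma$ is the vector space over $\mathbb{Z}_p$ of all sequences $x=(x_1,x_2,\dots)$ in $\mathbb{Z}_p$ with $x_k=0$ for all but finitely many $k$. With $\ker\omega=\{x\in\Gamma:\omega(x,\Gamma)=\{0\}\}$, the rank of $\omega$ is $\dim_{\mathbb{Z}_p}(\Gamma/\ker\omega)$. A sequence of unitary operators on a Hilbert space $H\ne\{0\}$ is irreducible if it is an irreducible set of operators, i.e. the only operators in $\mathcal B(H)$ commuting with all of the $U_k$ (and their adjoints) are scalars. $C^*(U_1,U_2,\dots)$ denotes the $C^*$-algebra generated by the operators. A UHF algebra of type $p^\infty$ is the ($C^*$-algebraic) infinite tensor product of copies of $M_p(\mathbb C)$. A spin system is a sequence of self-adjoint unitary operators $U_k$ with $U_iU_j=(-1)^{c_{ij}}U_jU_i$, $c_{ij}\in\{0,1\}$; $(c_{ij})$ is its commutation matrix, and the rank of the matrix is the rank of $\omega$. *)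

(* Defs.v *)
From HB Require Import structures.
From mathcomp Require Import all_boot all_order all_algebra.
From mathcomp Require Import sesquilinear complex mxtens.
From mathcomp Require Import all_classical all_reals all_analysis.

Set Implicit Arguments.
Unset Strict Implicit.
Unset Printing Implicit Defensive.

Import Order.TTheory GRing.Theory Num.Theory Num.Def.
Import numFieldNormedType.Exports.

Local Open Scope classical_set_scope.
Local Open Scope ring_scope.
Local Open Scope complex_scope.

Section Form.
Variables (p : nat) (c : nat -> nat -> 'F_p).

Definition skew_symmetric_mx : Prop :=
  forall i j, c i j = - c j i /\ c i i = 0.

(* The space Gamma of finitely supported sequences is encoded by {poly 'F_p}:
   the sequence x_1, x_2, ... is the coefficient sequence x`_0, x`_1, ...     *)
Definition omega (x y : {poly 'F_p}) : 'F_p :=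
  \sum_(i < size y) \sum_(j < size x) c i j * x`_j * y`_i.

Definition ker_omega : set {poly 'F_p} := [set x | forall y, omega x y = 0].

(* dim (Gamma / ker omega) is infinite: for every n there are n vectors of
   Gamma whose classes modulo ker omega are linearly independent.             *)
Definition infinite_rank : Prop :=
  forall n : nat, exists v : 'I_n -> {poly 'F_p},
    forall a : 'I_n -> 'F_p,
      ker_omega (\sum_(i < n) a i *: v i) -> forall i, a i = 0.

End Form.

Definition zeta (R : realType) (p : nat) : R[i] :=
  cos (2 * pi / p%:R) +i* sin (2 * pi / p%:R).

(* A Hilbert space is a complete normed space over R[i] together with an inner
   product inducing its norm; dot is linear in the first variable.            *)
Definition hilbert_dot (R : realType) (H : completeNormedModType R[i])
    (dot : {dot H for conjC}) : Prop :=
  forall x : H, `|x| ^+ 2 = dot x x.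

(* Operators are functions H -> H; sums and multiples are pointwise.          *)
Section Operators.
Variables (R : realType) (H : completeNormedModType R[i]).
Variable dot : {dot H for conjC}.
Implicit Types (S T : H -> H) (A : set (H -> H)) (U : nat -> H -> H).

(* In the partial order of R[i], M is forced to be real when H is nonzero, and
   0 < e below means that e is a positive real.                               *)
Definition norm_bound (T : H -> H) (M : R[i]) : Prop :=
  forall x, `|T x| <= M * `|x|.

Definition bounded_op : set (H -> H) :=
  [set T | linear T /\ exists M, norm_bound T M].

Definition is_adjoint S T : Prop := forall x y, dot (T x) y = dot x (S y).

Definition unitary_op T : Prop :=
  bounded_op T /\
  exists S, [/\ bounded_op S, is_adjoint S T, S \o T = id & T \o S = id].

Definition self_adjoint T : Prop := is_adjoint T T.

Definition scalar_op T : Prop := exists a : R[i], T = a *: (id : H -> H).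

Definition irreducible_seq U : Prop :=
  (exists x : H, x != 0) /\
  forall T, bounded_op T ->
    (forall k, T \o U k = U k \o T) ->
    (forall k S, bounded_op S -> is_adjoint S (U k) -> T \o S = S \o T) ->
    scalar_op T.

(* T is in the operator-norm closure of A.                                    *)
Definition norm_closure A : set (H -> H) :=
  [set T | bounded_op T /\
     forall e : R[i], 0 < e -> exists2 S, A S & norm_bound (T - S) e].

Record cstar_subalgebra A : Prop := {
  cstar_bounded : A `<=` bounded_op;
  cstar_zero : A 0;
  cstar_add : forall S T, A S -> A T -> A (S + T);
  cstar_scale : forall (a : R[i]) T, A T -> A (a *: T);
  cstar_comp : forall S T, A S -> A T -> A (S \o T);
  cstar_adjoint : forall S T, A T -> bounded_op S -> is_adjoint S T -> A S;
  cstar_closed : norm_closure A `<=` A }.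

Definition cstar_generated U : set (H -> H) :=
  smallest cstar_subalgebra (range U).

Fixpoint tensor_dim (p n : nat) : nat :=
  if n is m.+1 then (tensor_dim p m * p)%N else 1.

(* The n-fold tensor power of M_p(C), as matrices of size p ^ n.              *)
Definition tensor_power (p n : nat) := 'M[R[i]]_(tensor_dim p n).

Definition tensor_incl (p n : nat) (a : tensor_power p n) :
    tensor_power p n.+1 := tensmx a (1%:M : 'M[R[i]]_p).

Record star_embedding (N : nat) (f : 'M[R[i]]_N -> H -> H) : Prop := {
  star_embedding_linear : linear f;
  star_embedding_mul : forall a b, f (a *m b) = f a \o f b;
  star_embedding_adj : forall a, is_adjoint (f (map_mx conjC a^T)) (f a);
  star_embedding_inj : injective f }.

(* A is the C*-algebraic infinite tensor product of copies of M_p(C), i.e. the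
   C*-inductive limit of M_p(C)^{(x) n} under a |-> a (x) 1. Injective
   *-homomorphisms between C*-algebras are isometric, so iota exhibits A as
   the completion of the algebraic infinite tensor product. The common image
   of the units is by density the unit of A, which need not be id.            *)
Definition UHF_type (p : nat) A : Prop :=
  cstar_subalgebra A /\
  exists iota : forall n, tensor_power p n -> H -> H,
    [/\ forall n, star_embedding (iota n),
        forall n a, iota n.+1 (tensor_incl a) = iota n a,
        forall n a, A (iota n a) &
        A `<=` norm_closure (\bigcup_n range (iota n))].

(* c i j in 'F_p is used as an exponent through its representative < p.       *)
Definition spin_system (c : nat -> nat -> 'F_2) U : Prop :=
  [/\ forall k, unitary_op (U k),
      forall k, self_adjoint (U k) &
      forall i j, U i \o U j = (-1 : R[i]) ^+ (c i j : nat) *: (U j \o U i)].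

Definition CAR_algebra A : Prop := UHF_type 2 A.

End Operators.

(* Main.v *)
(** For x in Gamma let U^x be the product of the U_k^(x_k), in any order. These
monomials commute up to the powers zeta^(omega x y), and by irreducibility U^x
is a scalar as soon as x lies in ker omega. So U^x only depends, up to a
scalar, on the class of x modulo ker omega.

Since omega is alternating of infinite rank, a greedy symplectic Gram-Schmidt
process yields e_0, f_0, e_1, f_1, ... with omega e_i f_j = (i == j) and
omega e_i e_j = omega f_i f_j = 0, such that every basis vector of Gamma is in
their span modulo ker omega. After rescaling, W = U^(e_n) and V = U^(f_n)
satisfy V^p = W^p = 1 and V W = zeta W V, hence span a copy of M_p(C) whose
matrix units are W^i P W^(p - j), with P the average of the powers of V. These
copies commute with each other, so the first n of them form M_p(C)^{(x) n};
every U_k is in the union of this tower, which is therefore norm-dense. *)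
Require Import Defs.
From HB Require Import structures.
From mathcomp Require Import all_boot all_order all_algebra.
From mathcomp Require Import sesquilinear complex mxtens.
From mathcomp Require Import all_classical all_reals all_analysis.
From mathcomp Require Import ring.

Import Order.TTheory GRing.Theory Num.Theory Num.Def.
Import numFieldNormedType.Exports.
Local Open Scope ring_scope.
Local Open Scope complex_scope.

Set Implicit Arguments.
Unset Strict Implicit.
Unset Printing Implicit Defensive.

(** * Weyl pairs and matrix units *)

Section WeylPair.

Variables (F : fieldType) (A : algType F) (p : nat) (z : F) (V W : A).
Hypothesis pF_neq0 : p%:R != 0 :> F.
Hypothesis z_prim : p.-primitive_root z.
Hypothesis VXp : V ^+ p = 1.
Hypothesis WXp : W ^+ p = 1.
Hypothesis VW : V * W = z *: (W * V).

(** The spectral projection of [V] for the eigenvalue 1, as the average over the cyclic group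
    generated by [V]. *)
Definition weyl_proj := p%:R^-1 *: \sum_(k < p) V ^+ k.

(** [W ^+ (p - j)] plays the role of W^(-j). Since [W] multiplies eigenvalues of [V] by [z], this
    operator carries the eigenspace for z^j to the one for z^i. *)
Definition weyl_unit i j := W ^+ i * weyl_proj * W ^+ (p - j).

Lemma weyl_commX m : V * W ^+ m = z ^+ m *: (W ^+ m * V).
Proof.
elim: m => [|m IHm]; first by rewrite !expr0 mul1r mulr1 scale1r.
by rewrite !exprSr mulrA IHm -scalerAl -(mulrA _ V W) VW -scalerAr scalerA mulrA.
Qed.

Lemma weyl_commXX k m : V ^+ k * W ^+ m = z ^+ (k * m) *: (W ^+ m * V ^+ k).
Proof.
elim: k => [|k IHk]; first by rewrite !expr0 mul1r mulr1 scale1r.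
rewrite !exprSr -(mulrA _ V) weyl_commX -scalerAr (mulrA (V ^+ k)) IHk.
by rewrite -scalerAl scalerA !mulrA mulSn exprD.
Qed.

Lemma sum_weyl_shift : \sum_(k < p) V ^+ k.+1 = \sum_(k < p) V ^+ k.
Proof.
apply: (addrI (V ^+ 0)); rewrite -(big_ord_recl p (fun k => V ^+ k)).
by rewrite big_ord_recr VXp addrC.
Qed.

Lemma mul_weyl_proj : V * weyl_proj = weyl_proj.
Proof.
rewrite /weyl_proj -scalerAr mulr_sumr -[in RHS]sum_weyl_shift.
by under eq_bigr => k _ do rewrite -exprS.
Qed.

Lemma weyl_proj_mul : weyl_proj * V = weyl_proj.
Proof.
rewrite /weyl_proj -scalerAl mulr_suml -[in RHS]sum_weyl_shift.
by under eq_bigr => k _ do rewrite -exprSr.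
Qed.

Lemma weyl_projK : weyl_proj * weyl_proj = weyl_proj.
Proof.
have VP k : V ^+ k * weyl_proj = weyl_proj.
  by elim: k => [|k IHk]; rewrite ?mul1r // exprSr -mulrA mul_weyl_proj.
rewrite {1}/weyl_proj -scalerAl mulr_suml.
under eq_bigr => k _ do rewrite VP.
by rewrite sumr_const card_ord -scaler_nat scalerA mulVf ?scale1r.
Qed.

(* V fixes P on both sides, so moving V across W^m scales P W^m P by z^m. *)
Lemma weyl_proj_orth m :
  ~~ (p %| m)%N -> weyl_proj * W ^+ m * weyl_proj = 0.
Proof.
rewrite (prim_order_dvd z_prim) => zm_neq1.
move: weyl_proj weyl_proj_mul mul_weyl_proj => P PV VP.
have /eqP : P * W ^+ m * P = z ^+ m *: (P * W ^+ m * P).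
  rewrite -{1}PV -(mulrA P V) weyl_commX -scalerAr -scalerAl.
  by rewrite (mulrA P) -(mulrA _ V) VP.
rewrite -{1}[_ * _ * _]scale1r -subr_eq0 -scalerBl scaler_eq0 subr_eq0 eq_sym.
by rewrite (negPf zm_neq1) => /eqP.
Qed.

(** The exponent of [W] between the two projections is p - j + k. For j = k it is p and W^p = 1;
    otherwise p does not divide it, because j and k are below p, and the product vanishes. *)
Lemma weyl_unitM i j k l : (j < p)%N -> (k < p)%N ->
  weyl_unit i j * weyl_unit k l = if j == k then weyl_unit i l else 0.
Proof.
move=> j_lt k_lt; rewrite /weyl_unit !mulrA -(mulrA _ (W ^+ _) (W ^+ k)) -exprD.
rewrite -2!(mulrA (W ^+ i)).
have [->|j_neq] := eqVneq j k; first by rewrite subnK 1?ltnW // WXp mulr1 weyl_projK.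
rewrite weyl_proj_orth ?mulr0 ?mul0r // addnBAC 1?ltnW // -eqn_mod_dvd.
  by rewrite modnDl !modn_small // eq_sym.
by rewrite (leq_trans (ltnW j_lt)) ?leq_addr.
Qed.

(** Moving V^k past W^(p - i) brings the two powers of [W] together as W^p = 1 and leaves a sum of
    powers of z^k, which vanishes unless k = 0. *)
Lemma sum_weyl_unit : \sum_(i < p) weyl_unit i i = 1.
Proof.
have p_gt0 := prim_order_gt0 z_prim.
have -> : \sum_(i < p) weyl_unit i i
    = p%:R^-1 *: \sum_(k < p) (\sum_(i < p) z ^+ (k * (p - i))) *: V ^+ k.
  rewrite -(eq_bigr _ (fun k _ => esym (scaler_suml _ _ _ _))) exchange_big /=.
  rewrite scaler_sumr; apply: eq_bigr => i _.
  rewrite /weyl_unit /weyl_proj -scalerAr -scalerAl mulr_sumr mulr_suml.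
  congr (_ *: _); apply: eq_bigr => k _.
  by rewrite -mulrA weyl_commXX -scalerAr mulrA -exprD subnKC ?WXp ?mul1r // ltnW.
rewrite (bigD1 (Ordinal p_gt0)) //= [X in _ + X]big1 ?addr0 => [|k k_neq0].
  under eq_bigr => i _ do rewrite mul0n expr0.
  by rewrite sumr_const card_ord scalerA mulVf // scale1r expr0.
suff -> : \sum_(i < p) z ^+ (k * (p - i)) = 0 by rewrite scale0r.
have zk_neq1 : z ^+ k != 1.
  rewrite -(prim_order_dvd z_prim) gtnNdvd // lt0n.
  by apply: contraNneq k_neq0 => k0; apply/eqP/val_inj.
(* Reversing the index turns the exponents p - i into i + 1, so the sum is z^k times a geometric
   sum. *)
rewrite (reindex_inj rev_ord_inj) /=.
under eq_bigr => i _ do rewrite subKn // exprM exprS.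
rewrite -mulr_sumr; apply/eqP; rewrite mulf_eq0; apply/orP; right.
have : (z ^+ k - 1) * (\sum_(i < p) (z ^+ k) ^+ i) == 0.
  by rewrite -subrX1 exprAC (prim_expr_order z_prim) expr1n subrr.
by rewrite mulf_eq0 subr_eq0 (negPf zk_neq1).
Qed.

(** [V] is the clock matrix: it scales the i-th diagonal unit by z^i, and these units add up to
    1. *)
Lemma weyl_unit_span_diag :
  exists b : 'M[F]_p, V = \sum_i \sum_j b i j *: weyl_unit i j.
Proof.
exists (\matrix_(i, j) (z ^+ i *+ (i == j))).
rewrite -[LHS]mulr1 -sum_weyl_unit mulr_sumr; apply: eq_bigr => i _.
rewrite (bigD1 i) //= big1 => [|j j_neq]; last first.
  by rewrite mxE eq_sym (negPf j_neq) scale0r.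
rewrite addr0 mxE eqxx mulr1n /weyl_unit !mulrA weyl_commX -!scalerAl.
by rewrite -(mulrA _ V) mul_weyl_proj.
Qed.

(** [W] is the cyclic shift: it sends the j-th diagonal unit to the unit in row j + 1 and column j,
    the row being read modulo p because W^p = 1. *)
Lemma weyl_unit_span_shift :
  exists b : 'M[F]_p, W = \sum_i \sum_j b i j *: weyl_unit i j.
Proof.
exists (\matrix_(i, j) (i == (j.+1 %% p)%N :> nat)%:R).
rewrite exchange_big -[LHS]mulr1 -sum_weyl_unit mulr_sumr; apply: eq_bigr => j _ /=.
have lt_j : (j.+1 %% p < p)%N by rewrite ltn_mod (prim_order_gt0 z_prim).
rewrite (bigD1 (Ordinal lt_j)) //= big1 => [|i i_neq]; last first.
  by rewrite mxE -[_ == _ :> nat]/(i == Ordinal lt_j) (negPf i_neq) scale0r.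
by rewrite addr0 mxE eqxx scale1r /weyl_unit expr_mod // !mulrA -exprS.
Qed.

Lemma comm_weyl_unit x i j :
  GRing.comm x V -> GRing.comm x W -> GRing.comm x (weyl_unit i j).
Proof.
move=> xV xW; apply: commrM; last exact: commrX.
apply: commrM; first exact: commrX.
rewrite /weyl_proj /GRing.comm -scalerAr -scalerAl; congr (_ *: _).
by apply: commr_sum => k _; apply: commrX.
Qed.

End WeylPair.

(** * Towers of commuting matrix units *)

Section MatrixUnitExtension.

Variables (F : fieldType) (A : algType F) (N q : nat).
Variables (f : 'M[F]_N -> A) (E : 'I_q -> 'I_q -> A).

(** The coefficient of the matrix unit e_ij when [a] is read in M_N (x) M_q, with M_q as the right
    factor. *)
Definition tens_block (a : 'M[F]_(N * q)) (i j : 'I_q) : 'M[F]_N :=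
  \matrix_(k, l) a (mxtens_index (k, i)) (mxtens_index (l, j)).

(** The map on M_N (x) M_q that sends a (x) e_ij to f a * E i j. *)
Definition matrix_unit_ext (a : 'M[F]_(N * q)) : A :=
  \sum_i \sum_j f (tens_block a i j) * E i j.

Lemma tens_blockP i j : linear (fun a => tens_block a i j).
Proof. by move=> c a b; apply/matrixP=> k l; rewrite !mxE. Qed.

Lemma tens_block_mul a b i j :
  tens_block (a *m b) i j = \sum_k tens_block a i k *m tens_block b k j.
Proof.
apply/matrixP=> k l; rewrite summxE !mxE.
under [RHS]eq_bigr => i' _ do rewrite mxE.
rewrite exchange_big pair_big /=.
rewrite (reindex (@mxtens_index N q)) /=; last first.
  by exists (@mxtens_unindex N q) => x _; rewrite (mxtens_indexK, mxtens_unindexK).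
by apply: eq_bigr => -[k' l'] _; rewrite !mxE.
Qed.

Lemma tens_block_tensmx (a : 'M[F]_N) (b : 'M[F]_q) i j :
  tens_block (tensmx a b) i j = b i j *: a.
Proof. by apply/matrixP=> k l; rewrite !mxE !mxtens_indexK mulrC. Qed.

Lemma eq_tens_block0 a : (forall i j, tens_block a i j = 0) -> a = 0.
Proof.
move=> a0; apply/matrixP=> k l.
case: (mxtens_indexP k) => k1 k2; case: (mxtens_indexP l) => l1 l2.
by have /matrixP/(_ k1 l1) := a0 k2 l2; rewrite !mxE.
Qed.

Hypothesis f_linear : linear f.
Hypothesis fM : forall a b, f (a *m b) = f a * f b.
Hypothesis EM : forall i j k l, E i j * E k l = if j == k then E i l else 0.
Hypothesis E1 : \sum_i E i i = 1.
Hypothesis fE : forall a i j, GRing.comm (f a) (E i j).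

Let fL : {linear 'M[F]_N -> A} :=
  HB.pack f (GRing.isLinear.Build F _ _ _ f f_linear).

Let f_sum I r (P : pred I) (a : I -> 'M[F]_N) :
  f (\sum_(i <- r | P i) a i) = \sum_(i <- r | P i) f (a i).
Proof. exact: (linear_sum fL). Qed.

Let f_scale c a : f (c *: a) = c *: f a.
Proof. exact: (linearZ_LR fL). Qed.

Lemma matrix_unit_ext_linear : linear matrix_unit_ext.
Proof.
move=> c a b; rewrite scaler_sumr -big_split; apply: eq_bigr => i _ /=.
rewrite scaler_sumr -big_split; apply: eq_bigr => j _ /=.
by rewrite tens_blockP f_linear mulrDl scalerAl.
Qed.

(** This is block matrix multiplication: the units [E] move past the values of [f], and E i k * E k'
    j survives only for k = k'. *)
Lemma matrix_unit_extM a b :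
  matrix_unit_ext (a *m b) = matrix_unit_ext a * matrix_unit_ext b.
Proof.
rewrite mulr_suml; apply: eq_bigr => i _.
transitivity (\sum_j \sum_k f (tens_block a i k) * f (tens_block b k j) * E i j).
  apply: eq_bigr => j _; rewrite tens_block_mul f_sum mulr_suml.
  by apply: eq_bigr => k _; rewrite /= fM.
rewrite exchange_big mulr_suml; apply: eq_bigr => k _ /=.
rewrite [in RHS]/matrix_unit_ext mulr_sumr [RHS](bigD1 k) //=
  [X in _ = _ + X]big1 => [|k' k'_neq].
  rewrite addr0 mulr_sumr; apply: eq_bigr => j _.
  by rewrite -!mulrA; congr (_ * _); rewrite mulrA -fE -mulrA EM eqxx.
rewrite mulr_sumr big1 // => j _.
by rewrite mulrA -(mulrA (f _)) -fE mulrA -mulrA EM eq_sym (negPf k'_neq) mulr0.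
Qed.

Lemma matrix_unit_ext_tensmx a b :
  matrix_unit_ext (tensmx a b) = f a * \sum_i \sum_j b i j *: E i j.
Proof.
rewrite mulr_sumr; apply: eq_bigr => i _; rewrite mulr_sumr; apply: eq_bigr => j _.
by rewrite tens_block_tensmx f_scale -scalerAl scalerAr.
Qed.

Lemma matrix_unit_ext_incl a : matrix_unit_ext (tensmx a 1%:M) = f a.
Proof.
rewrite matrix_unit_ext_tensmx -[RHS]mulr1 -E1; congr (_ * _).
apply: eq_bigr => i _; rewrite (bigD1 i) //= big1 => [|j j_neq].
  by rewrite addr0 mxE eqxx scale1r.
by rewrite mxE eq_sym (negPf j_neq) scale0r.
Qed.

(* Compressing by the matrix units recovers the blocks:
   \sum_k E k i * x * E j k is the block f a_ij when x = \sum f a_ij * E i j. *)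
Lemma matrix_unit_ext_inj : (forall a, f a = 0 -> a = 0) ->
  forall a, matrix_unit_ext a = 0 -> a = 0.
Proof.
move=> f_inj a a0; apply: eq_tens_block0 => i j; apply: f_inj.
have : \sum_k E k i * matrix_unit_ext a * E j k = 0.
  by rewrite a0 big1 // => k _; rewrite mulr0 mul0r.
move=> <-; rewrite -[LHS]mulr1 -E1 mulr_sumr; apply: eq_bigr => k _.
rewrite /matrix_unit_ext mulr_sumr mulr_suml [RHS](bigD1 i) //=
  [X in _ = _ + X]big1 => [|i' i'_neq].
  rewrite addr0 mulr_sumr mulr_suml [RHS](bigD1 j) //=
    [X in _ = _ + X]big1 => [|j' j'_neq].
    by rewrite addr0 mulrA -fE -!mulrA EM eqxx EM eqxx.
  by rewrite -!mulrA EM (negPf j'_neq) !mulr0.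
rewrite mulr_sumr mulr_suml big1 // => j' _.
by rewrite mulrA -fE -(mulrA (f _)) EM eq_sym (negPf i'_neq) mulr0 mul0r.
Qed.

End MatrixUnitExtension.

(** * Iterated tensor products of commuting matrix units *)

Section MatrixUnitTower.

Variables (F : fieldType) (A : algType F) (q : nat).
Variable E : nat -> 'I_q -> 'I_q -> A.

(** The newest tensor factor is on the right, as in [tensor_incl]. [tensor_dim q 0] is 1, so the
    bottom level consists of the scalars. *)
Fixpoint matrix_tower n : 'M[F]_(tensor_dim q n) -> A :=
  if n is m.+1 then matrix_unit_ext (@matrix_tower m) (E m)
  else fun a : 'M[F]_1 => (a 0 0)%:A.

Hypothesis EM : forall n i j k l, E n i j * E n k l = if j == k then E n i l else 0.
Hypothesis E1 : forall n, \sum_i E n i i = 1.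
Hypothesis EC : forall m n i j k l, (m < n)%N -> GRing.comm (E m i j) (E n k l).

Lemma matrix_tower_linear n : linear (@matrix_tower n).
Proof.
elim: n => [|n IHn] /=; last exact: matrix_unit_ext_linear.
by move=> c a b; rewrite !mxE scalerDl scalerA.
Qed.

HB.instance Definition _ n :=
  GRing.isLinear.Build F _ _ _ (@matrix_tower n) (@matrix_tower_linear n).

Lemma matrix_tower_comm n x a :
  (forall m i j, (m < n)%N -> GRing.comm x (E m i j)) ->
  GRing.comm x (matrix_tower (n := n) a).
Proof.
elim: n a => [|n IHn] a xE /=; first by rewrite /GRing.comm -scalerAr -scalerAl mulr1 mul1r.
apply: commr_sum => i _; apply: commr_sum => j _; apply: commrM; last exact: xE.
by apply: IHn => m k l lt_mn; apply: xE; apply: ltnW.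
Qed.

Lemma matrix_tower_unit_comm n a i j : GRing.comm (matrix_tower (n := n) a) (E n i j).
Proof.
by apply/commr_sym/matrix_tower_comm => m k l lt_mn; apply/commr_sym/EC.
Qed.

Lemma matrix_towerM n (a b : 'M[F]_(tensor_dim q n)) :
  matrix_tower (a *m b) = matrix_tower a * matrix_tower b.
Proof.
elim: n a b => [|n IHn] a b /=.
  by rewrite mxE big_ord1 -scalerAl mul1r scalerA.
by apply: matrix_unit_extM => //; [exact: matrix_tower_linear|exact: matrix_tower_unit_comm].
Qed.

Lemma matrix_tower_incl n (a : 'M[F]_(tensor_dim q n)) :
  @matrix_tower n.+1 (tensmx a 1%:M) = matrix_tower a.
Proof. by apply: matrix_unit_ext_incl => //; exact: matrix_tower_linear. Qed.

Lemma matrix_tower_inj n (a : 'M[F]_(tensor_dim q n)) : matrix_tower a = 0 -> a = 0.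
Proof.
elim: n a => [|n IHn] a /=.
  move/eqP; rewrite scaler_eq0 oner_eq0 orbF => /eqP a0.
  by apply/matrixP => i j; rewrite !ord1 a0 mxE.
by apply: matrix_unit_ext_inj => //; [exact: matrix_tower_unit_comm].
Qed.

Definition tower_range n x := exists a : 'M[F]_(tensor_dim q n), x = matrix_tower a.

Lemma tower_range_subalg n : [/\ tower_range n 1,
  forall c x, tower_range n x -> tower_range n (c *: x),
  forall x y, tower_range n x -> tower_range n y -> tower_range n (x + y) &
  forall x y, tower_range n x -> tower_range n y -> tower_range n (x * y)].
Proof.
split.
- elim: n => [|n [a a1]]; first by exists 1%:M; rewrite /= mxE eqxx scale1r.
  by exists (tensmx a 1%:M); rewrite matrix_tower_incl.
- by move=> c _ [a ->]; exists (c *: a); rewrite linearZ.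
- by move=> _ _ [a ->] [b ->]; exists (a + b); rewrite linearD.
- by move=> _ _ [a ->] [b ->]; exists (a *m b); rewrite matrix_towerM.
Qed.

Lemma tower_rangeS n x : tower_range n x -> tower_range n.+1 x.
Proof. by case=> a ->; exists (tensmx a 1%:M); rewrite matrix_tower_incl. Qed.

Lemma tower_range_le m n x : (m <= n)%N -> tower_range m x -> tower_range n x.
Proof.
move=> le_mn; rewrite -(subnKC le_mn); elim: (n - m)%N => [|d IHd] mx.
  by rewrite addn0.
by rewrite addnS; apply/tower_rangeS/IHd.
Qed.

Lemma tower_range_unit n (b : 'M[F]_q) :
  tower_range n.+1 (\sum_i \sum_j b i j *: E n i j).
Proof.
have [[a a1] _ _ _] := tower_range_subalg n.
exists (tensmx a b) => /=.
by rewrite matrix_unit_ext_tensmx -?a1 ?mul1r //; exact: matrix_tower_linear.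
Qed.

End MatrixUnitTower.

(** * Symplectic sequences *)

Definition update T (u : nat -> T) n t i := if i == n then t else u i.

(** A form of dependent choice. Stage n fixes entry n and leaves the others alone, so entry i is
    final from stage i + 1 on. As [P n] sees only the entries below n, the diagonal of the stages
    satisfies every [P n]. *)
Lemma prefix_choice T (P : nat -> (nat -> T) -> Prop) (u0 : nat -> T) :
  (forall n u v, (forall i, (i < n)%N -> u i = v i) -> P n u -> P n v) ->
  P 0 u0 -> (forall n u, P n u -> exists t, P n.+1 (update u n t)) ->
  exists u, forall n, P n u.
Proof.
move=> P_ext P0 step.
have next n (u : {u | P n u}) : {t | P n.+1 (update (sval u) n t)}.
  by apply/cid; case: u => u; apply: step.
pose fix st n : {u | P n u} := if n is m.+1
  then exist _ (update (sval (st m)) m (sval (next m (st m)))) (svalP (next m (st m)))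
  else exist _ u0 P0.
exists (fun i => sval (st i.+1) i) => n; apply: P_ext (svalP (st n)) => i.
elim: n => [//|n IHn]; rewrite ltnS leq_eqVlt => /orP[/eqP -> //|lt_in].
by rewrite -IHn //= /update (ltn_eqF lt_in).
Qed.

Section SymplecticSequence.

Variables (F : fieldType) (V : lmodType F) (w : V -> V -> F) (b : nat -> V).
Hypothesis w_linear : forall y, scalar (w^~ y).
Hypothesis w_skew : forall x y, w x y = - w y x.
Hypothesis w_alt : forall x, w x x = 0.
Hypothesis b_span : forall x, exists n (a : 'I_n -> F), x = \sum_i a i *: b i.
Hypothesis w_infinite_rank : forall n, exists v : 'I_n -> V, forall a : 'I_n -> F,
  (forall y, w (\sum_i a i *: v i) y = 0) -> forall i, a i = 0.

Implicit Types (u : nat -> V * V) (x y : V).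

Definition hyperbolic u n := forall i j, (i < n)%N -> (j < n)%N ->
  [/\ w (u i).1 (u j).2 = (i == j)%:R, w (u i).1 (u j).1 = 0 &
      w (u i).2 (u j).2 = 0].

(** For hyperbolic [u] this is the [w]-orthogonal projection onto the span of the first n pairs
    (e_i, f_i); the minus sign reflects w f_i e_i = -1. *)
Definition hyperbolic_part u n x :=
  \sum_(i < n) (w x (u i).2 *: (u i).1 - w x (u i).1 *: (u i).2).

Let red u n x := x - hyperbolic_part u n x.

Let wDl x x' y : w (x + x') y = w x y + w x' y.
Proof. by have := w_linear y 1 x x'; rewrite scale1r mul1r. Qed.

Let w0l y : w 0 y = 0.
Proof. by apply: (addrI (w 0 y)); rewrite -wDl !addr0. Qed.

Let wZl a x y : w (a *: x) y = a * w x y.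
Proof. by have := w_linear y a x 0; rewrite addr0 w0l addr0. Qed.

Let wNl x y : w (- x) y = - w x y.
Proof. by rewrite -scaleN1r wZl mulN1r. Qed.

Let w_suml I r (P : pred I) (x : I -> V) y :
  w (\sum_(i <- r | P i) x i) y = \sum_(i <- r | P i) w (x i) y.
Proof. by apply: (big_morph (w^~ y)) => [x1 x2|]; rewrite ?wDl ?w0l. Qed.

Let wDr x y y' : w x (y + y') = w x y + w x y'.
Proof. by rewrite w_skew wDl opprD -!w_skew. Qed.

Let wZr a x y : w x (a *: y) = a * w x y.
Proof. by rewrite w_skew wZl -mulrN -w_skew. Qed.

Let wNr x y : w x (- y) = - w x y.
Proof. by rewrite -scaleN1r wZr mulN1r. Qed.

Let w_sumr I r (P : pred I) x (y : I -> V) :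
  w x (\sum_(i <- r | P i) y i) = \sum_(i <- r | P i) w x (y i).
Proof. by rewrite w_skew w_suml -sumrN; apply: eq_bigr => i _; rewrite -w_skew. Qed.

Lemma hyperbolic_part_orth u n x j : hyperbolic u n -> (j < n)%N ->
  w (red u n x) (u j).1 = 0 /\ w (red u n x) (u j).2 = 0.
Proof.
move=> hyp lt_jn; pose j' := Ordinal lt_jn.
have [Eef Eee Eff] := hyp _ _ lt_jn lt_jn.
split; rewrite /red wDl wNl w_suml (bigD1 j') //= big1 => [|i /negPf i_neq].
- rewrite addr0 wDl wNl !wZl (w_skew (u j).2 (u j).1) Eef Eee eqxx.
  by rewrite mulr0 sub0r mulrN mulr1 opprK subrr.
- have [_ Eee' _] := hyp _ _ (ltn_ord i) lt_jn.
  have [Eef' _ _] := hyp _ _ lt_jn (ltn_ord i).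
  rewrite wDl wNl !wZl Eee' mulr0 (w_skew (u i).2) Eef' -[j]/(val j') eq_sym.
  by rewrite val_eqE i_neq oppr0 mulr0 subrr.
- by rewrite addr0 wDl wNl !wZl Eef Eff eqxx mulr0 subr0 mulr1 subrr.
- have [Eef' _ Eff'] := hyp _ _ (ltn_ord i) lt_jn.
  by rewrite wDl wNl !wZl Eff' mulr0 Eef' -[j]/(val j') val_eqE i_neq mulr0 subrr.
Qed.

(** [y] and [red u n y] differ by a combination of the first n pairs, to which [red u n x] is
    orthogonal. *)
Lemma red_orth_red u n x y : hyperbolic u n -> w (red u n x) (red u n y) = w (red u n x) y.
Proof.
move=> hyp; rewrite [in LHS]/(red u n y) wDr wNr w_sumr big1 ?subr0 // => i _.
have [orth1 orth2] := hyperbolic_part_orth x hyp (ltn_ord i).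
by rewrite wDr wNr !wZr orth1 orth2 !mulr0 subrr.
Qed.

Lemma hyperbolic_ext u v n x : (forall i, (i < n)%N -> u i = v i) ->
  hyperbolic u n -> hyperbolic v n /\ red u n x = red v n x.
Proof.
move=> uv hyp; split=> [i j lt_in lt_jn|]; first by rewrite -!uv //; apply: hyp.
by congr (_ - _); apply: eq_bigr => i _; rewrite uv.
Qed.

Lemma red_update u n t x :
  red (update u n t) n.+1 x = red u n x - (w x t.2 *: t.1 - w x t.1 *: t.2).
Proof.
rewrite /red /hyperbolic_part big_ord_recr /= /update eqxx opprD addrA.
by congr (_ - _ - _); apply: eq_bigr => i _; rewrite ltn_eqF.
Qed.

Lemma red_scalar u n y : scalar (fun x => w (red u n x) y).
Proof.
move=> a x x' /=; rewrite /red !wDl !wNl wZl mulrDr addrACA; congr (_ + _).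
rewrite mulrN -opprD /hyperbolic_part !w_suml mulr_sumr -big_split.
congr (- _); apply: eq_bigr => i _ /=.
by rewrite !wDl !wNl !wZl; ring.
Qed.

(* Vectors x with red x = x are cut out by 2n linear conditions, so among the
   combinations of 2n + 1 independent vectors one lies outside the radical. *)
Lemma red_not_in_radical u n : exists k y, w (red u n (b k)) y != 0.
Proof.
apply: contrapT => no_k.
have red0 k y : w (red u n (b k)) y = 0.
  by apply: contrapT => /eqP Ek; apply: no_k; exists k, y.
have {}red0 x y : w (red u n x) y = 0.
  have [m [a ->]] := b_span x.
  pose g : {scalar V} := HB.pack (fun x => w (red u n x) y)
    (GRing.isLinear.Build F V F _ _ (@red_scalar u n y)).
  rewrite -[LHS]/(g _) linear_sum big1 // => i _.
  by rewrite linearZ /= red0 mulr0.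
have [v v_free] := w_infinite_rank (n + n).+1.
(* There are more rows than columns, so the left kernel is non-zero. A non-zero row in it gives a
   combination of the v_i orthogonal to all n pairs. *)
pose M : 'M[F]_((n + n).+1, n + n) :=
  row_mx (\matrix_(i < (n + n).+1, j < n) w (v i) (u j).1)
           (\matrix_(i < (n + n).+1, j < n) w (v i) (u j).2).
have kerM_neq0 : kermx M != 0.
  by rewrite -mxrank_eq0 mxrank_ker subn_eq0 -ltnNge ltnS rank_leq_col.
have := nz_row_eq0 (kermx M); rewrite (negPf kerM_neq0).
have /sub_kermxP := nz_row_sub (kermx M); set a := nz_row _ => aM.
case/eqP; apply/rowP => i; rewrite [RHS]mxE; move: i.
apply: v_free => y; set x := \sum_i _.
suff part0 : hyperbolic_part u n x = 0 by have := red0 x y; rewrite /red part0 subr0.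
move: aM; rewrite mul_mx_row -row_mx0 => /eq_row_mx[a1 a2].
rewrite /hyperbolic_part big1 // => j _.
have -> : w x (u j).1 = 0.
  have /rowP/(_ j) := a1; rewrite !mxE => <-.
  by rewrite w_suml; apply: eq_bigr => i _; rewrite wZl mxE.
have -> : w x (u j).2 = 0.
  have /rowP/(_ j) := a2; rewrite !mxE => <-.
  by rewrite w_suml; apply: eq_bigr => i _; rewrite wZl mxE.
by rewrite !scale0r subrr.
Qed.

(** Greedy Gram-Schmidt: the first basis vector whose residue is outside the radical supplies e_n,
    and the residue of a vector pairing with it supplies f_n. Infinite rank keeps the process from
    stopping. *)
Lemma symplectic_sequence : exists u : nat -> V * V,
  (forall n, hyperbolic u n) /\
  forall n k y, (k < n)%N -> w (b k - hyperbolic_part u n (b k)) y = 0.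
Proof.
have [|//|n u [hyp cover]|u Pu] := @prefix_choice _ (fun n u => hyperbolic u n /\
  forall k y, (k < n)%N -> w (red u n (b k)) y = 0) (fun=> (0, 0)).
- move=> n u v uv [hyp cover]; split; first by have [] := hyperbolic_ext 0 uv hyp.
  by move=> k y /cover; have [_ ->] := hyperbolic_ext (b k) uv hyp.
- have exk : exists k, `[<exists y, w (red u n (b k)) y != 0>].
    by have [k Ek] := red_not_in_radical u n; exists k; apply/asboolP.
  (* Taking the least k keeps b_0, ..., b_n covered after the extension. *)
  have [k /asboolP[y wy_neq0] k_min] := ex_minnP exk.
  have {}k_min k' y' : (k' < k)%N -> w (red u n (b k')) y' = 0.
    move=> lt_k'; apply: contrapT => /eqP neq0.
    move: lt_k'; rewrite ltnNge => /negP; apply; apply: k_min.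
    by apply/asboolP; exists y'.
  have le_nk : (n <= k)%N.
    by rewrite leqNgt; apply: contraNN wy_neq0 => /cover ->.
  pose e := red u n (b k).
  (* Replacing [y] by its residue does not change its pairing with [e], so this scaling makes w e f
     = 1. *)
  pose f := (w e y)^-1 *: red u n y.
  have wef : w e f = 1 by rewrite wZr red_orth_red // mulVf.
  have e_orth j : (j < n)%N -> w e (u j).1 = 0 /\ w e (u j).2 = 0.
    exact: hyperbolic_part_orth.
  have f_orth j : (j < n)%N -> w f (u j).1 = 0 /\ w f (u j).2 = 0.
    by move=> lt_jn; have [E1 E2] := hyperbolic_part_orth y hyp lt_jn;
      rewrite !wZl E1 E2 mulr0.
  exists (e, f); split.
    move=> i j; rewrite !ltnS (leq_eqVlt i) (leq_eqVlt j) /update.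
    move=> /predU1P[->|lt_in] /predU1P[->|lt_jn]; rewrite ?eqxx.
    + by rewrite /= wef !w_alt.
    + have [E1 E2] := e_orth _ lt_jn; have [E3 E4] := f_orth _ lt_jn.
      by rewrite (ltn_eqF lt_jn) (gtn_eqF lt_jn) /= E1 E2 E4.
    + have [E1 E2] := e_orth _ lt_in; have [E3 E4] := f_orth _ lt_in.
      rewrite (ltn_eqF lt_in) /= !(w_skew _ f) (w_skew _ e) E1 E3 E4.
      by rewrite oppr0.
    + by rewrite (ltn_eqF lt_in) (ltn_eqF lt_jn); apply: hyp.
  move=> k' y'; rewrite ltnS => le_k'n; rewrite red_update.
  (* A vector orthogonal to the old pairs pairs with [x] as it does with the residue of [x]. *)
  have w_red x z : (forall j, (j < n)%N -> w z (u j).1 = 0 /\ w z (u j).2 = 0) ->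
      w x z = w (red u n x) z.
    move=> z_orth; rewrite /red wDl wNl w_suml big1 ?subr0 // => i _.
    have [E1 E2] := z_orth _ (ltn_ord i).
    by rewrite w_skew wDr wNr !wZr E1 E2 !mulr0 subrr oppr0.
  rewrite (w_red _ f f_orth) (w_red _ e e_orth) /=.
  (* For k' = k the new pair removes the residue [e] entirely. For k' < k the residue is already in
     the radical, so the new coefficients are 0. *)
  have := leq_trans le_k'n le_nk; rewrite leq_eqVlt => /orP[/eqP ->|lt_k'k].
    by rewrite -/e wef w_alt scale1r scale0r subr0 subrr w0l.
  by rewrite !k_min // !scale0r !subr0 k_min.
exists u; split=> [n|n k y lt_kn]; first by have [] := Pu n.
by have [_ ] := Pu n; apply.
Qed.

End SymplecticSequence.

(** * The algebra of bounded operators *)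

Section BoundedOperators.

Variables (R : realType) (H : completeNormedModType R[i]).
Implicit Types (S T : H -> H) (x y : H).

(** On the zero space a bound [M] may be any complex number. In general M * |x| is nonnegative,
    hence equal to its own modulus |M| * |x|. *)
Lemma norm_bound_ge0 T M : norm_bound T M -> exists2 M', 0 <= M' & norm_bound T M'.
Proof.
move=> TM; exists `|M| => // x; apply: le_trans (TM x) _.
have Mx_ge0 : 0 <= M * `|x| by apply: le_trans (TM x).
by rewrite -(ger0_norm Mx_ge0) normrM normr_id.
Qed.

Lemma bounded_opP T : bounded_op T <->
  linear T /\ exists2 M, 0 <= M & norm_bound T M.
Proof.
split=> [[T_lin [M /norm_bound_ge0[M' M'0 TM']]]|[T_lin [M _ TM]]].
  by split=> //; exists M'.
by split=> //; exists M.
Qed.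

Lemma norm_boundD S T M N :
  norm_bound S M -> norm_bound T N -> norm_bound (S + T) (M + N).
Proof.
move=> SM TN x; rewrite mulrDl.
by apply: (le_trans (ler_normD _ _)); apply: lerD.
Qed.

Lemma norm_boundZ a T M : norm_bound T M -> norm_bound (a *: T) (`|a| * M).
Proof. by move=> TM x; rewrite normrZ -mulrA ler_wpM2l. Qed.

Lemma norm_bound_comp S T M N : 0 <= M ->
  norm_bound S M -> norm_bound T N -> norm_bound (S \o T) (M * N).
Proof.
by move=> M0 SM TN x; apply: (le_trans (SM _)); rewrite -mulrA ler_wpM2l.
Qed.

Lemma bounded_op0 : bounded_op (0 : H -> H).
Proof.
split; first by move=> a x y; rewrite scaler0 addr0.
by exists 0 => x; rewrite mul0r normr0.
Qed.

Lemma bounded_op_id : bounded_op (id : H -> H).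
Proof. by split=> //; exists 1 => x; rewrite mul1r. Qed.

Lemma bounded_opD S T : bounded_op S -> bounded_op T -> bounded_op (S + T).
Proof.
move=> [S_lin [M SM]] [T_lin [N TN]]; split; last by exists (M + N); apply: norm_boundD.
by move=> a x y; rewrite /= !fctE S_lin T_lin scalerDr addrACA.
Qed.

Lemma bounded_opZ a T : bounded_op T -> bounded_op (a *: T).
Proof.
move=> [T_lin [M TM]]; split; last by exists (`|a| * M); apply: norm_boundZ.
by move=> b x y; rewrite /= !fctE T_lin scalerDr !scalerA mulrC.
Qed.

Lemma bounded_op_comp S T : bounded_op S -> bounded_op T -> bounded_op (S \o T).
Proof.
move=> /bounded_opP[S_lin [M M0 SM]] [T_lin [N TN]].
split; last by exists (M * N); apply: norm_bound_comp.
by move=> a x y; rewrite /= T_lin S_lin.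
Qed.

Definition bounded_op_pred : {pred (H -> H)} := fun T => `[<bounded_op T>].

Lemma bounded_op_submod : GRing.subsemimod_closed bounded_op_pred.
Proof.
split; first split.
- by apply/asboolP/bounded_op0.
- by move=> S T /asboolP bS /asboolP bT; apply/asboolP/bounded_opD.
- by move=> a T /asboolP bT; apply/asboolP/bounded_opZ.
Qed.

HB.instance Definition _ :=
  GRing.isSubmodClosed.Build R[i] (H -> H) bounded_op_pred bounded_op_submod.

(* MathComp algebras are nontrivial rings, hence the witness that H is not 0. *)
Record bop (nz : exists x : H, x != 0) :=
  Bop { bop_fun :> H -> H; _ : bop_fun \in bounded_op_pred }.

Variable nz : exists x : H, x != 0.
Local Notation op := (bop nz).

HB.instance Definition _ := [isSub for @bop_fun nz].
HB.instance Definition _ := [Choice of op by <:].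
HB.instance Definition _ := [SubChoice_isSubLmodule of op by <:].

Implicit Types A B C : op.

Lemma bopP A : bounded_op A.
Proof. by case: A => T /= /asboolP. Qed.

Definition bop_of T (bT : bounded_op T) : op := Bop nz (asboolT bT).

Lemma bop_ext A B : (A : H -> H) = B -> A = B.
Proof. exact: val_inj. Qed.

Definition bop1 : op := bop_of bounded_op_id.
Definition bop_mul A B : op := bop_of (bounded_op_comp (bopP A) (bopP B)).

Lemma bop_linear A : linear A.
Proof. by case: (bopP A). Qed.

Lemma bop_mulA : associative bop_mul. Proof. by move=> A B C; apply: bop_ext. Qed.
Lemma bop_mul1l : left_id bop1 bop_mul. Proof. by move=> A; apply: bop_ext. Qed.
Lemma bop_mul1r : right_id bop1 bop_mul. Proof. by move=> A; apply: bop_ext. Qed.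
Lemma bop_mulDl : left_distributive bop_mul +%R.
Proof. by move=> A B C; apply: bop_ext. Qed.
Lemma bop_mulDr : right_distributive bop_mul +%R.
Proof.
move=> A B C; apply: bop_ext; apply/funext => x /=.
by have := bop_linear A 1 (B x) (C x); rewrite !scale1r.
Qed.
Lemma bop1_neq0 : bop1 != 0.
Proof.
have [x x_neq0] := nz; apply: contraNneq x_neq0 => /(congr1 (fun A => bop_fun A x)).
by move=> /= ->.
Qed.

HB.instance Definition _ := GRing.Zmodule_isNzRing.Build op
  bop_mulA bop_mul1l bop_mul1r bop_mulDl bop_mulDr bop1_neq0.

Lemma bop_scaleAl (a : R[i]) A B : a *: (A * B) = (a *: A) * B.
Proof. exact: bop_ext. Qed.

HB.instance Definition _ := GRing.Lmodule_isLalgebra.Build R[i] op bop_scaleAl.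

Lemma bop_scaleAr (a : R[i]) A B : a *: (A * B) = A * (a *: B).
Proof.
apply: bop_ext; apply/funext => x /=.
have A0 : A 0 = 0 by have := bop_linear A (-1) 0 0; rewrite scaler0 addr0 scaleN1r addNr.
by have := bop_linear A a (B x) 0; rewrite A0 !addr0.
Qed.

HB.instance Definition _ := GRing.Lalgebra_isAlgebra.Build R[i] op bop_scaleAr.

End BoundedOperators.

(** * Adjoints and norm closures *)

Section Adjoints.

Variables (R : realType) (H : completeNormedModType R[i]).
Variables (dot : {dot H for conjC}) (hdot : hilbert_dot dot).
Implicit Types (S T : H -> H) (x y : H).

Lemma dotC x y : dot x y = (dot y x)^*%R.
Proof. by rewrite hermC expr0 mul1r. Qed.

(** Cauchy-Schwarz: the square norm of x - a y, where a y is the projection of [x] on [y], expands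
    to |x|^2 - |dot x y|^2 / |y|^2. *)
Lemma dot_normM x y : `|dot x y| <= `|x| * `|y|.
Proof.
have [->|y_neq0] := eqVneq y 0; first by rewrite linear0r !normr0 mulr0.
have yy_gt0 : 0 < `|y| ^+ 2 by rewrite exprn_gt0 ?normr_gt0.
rewrite -(@ler_pXn2r _ 2) ?nnegrE ?mulr_ge0 // exprMn -ler_pdivrMr //.
have yy : dot y y = `|y| ^+ 2 by rewrite hdot.
move: (`|y| ^+ 2) yy yy_gt0 => n yy n_gt0.
have nJ : n^*%R = n by rewrite geC0_conj ?ltW.
pose a := dot x y / n.
have : 0 <= dot (x - a *: y) (x - a *: y) by exact: dnorm_ge0.
rewrite dnormB dnormZ linearZr_LR /= -hdot yy.
have -> : a^*%R * dot x y = `|dot x y| ^+ 2 / n.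
  by rewrite /a rmorphM /= fmorphV /= nJ normCK mulrAC [_ * dot x y]mulrC.
have -> : `|a| ^+ 2 * n = `|dot x y| ^+ 2 / n.
  rewrite normrM normfV (ger0_norm (ltW n_gt0)) exprMn -mulrA; congr (_ * _).
  by rewrite expr2 -mulrA mulVf ?mulr1 // gt_eqF.
rewrite [(_ / _)^*%R]geC0_conj; last by rewrite divr_ge0 ?exprn_ge0 // ltW.
by rewrite opprD addrA addrK subr_ge0.
Qed.

Lemma is_adjoint_sym S T : is_adjoint dot S T -> is_adjoint dot T S.
Proof. by move=> adj x y; rewrite dotC -adj -dotC. Qed.

Lemma is_adjointD S S' T T' : is_adjoint dot S T -> is_adjoint dot S' T' ->
  is_adjoint dot (S + S') (T + T').
Proof. by move=> adj adj' x y; rewrite !fctE linearDl linearDr /= adj adj'. Qed.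

Lemma is_adjointZ a S T : is_adjoint dot S T -> is_adjoint dot (a^*%R *: S) (a *: T).
Proof. by move=> adj x y; rewrite !fctE linearZl_LR linearZr_LR /= conjCK adj. Qed.

Lemma is_adjoint_comp S S' T T' : is_adjoint dot S T -> is_adjoint dot S' T' ->
  is_adjoint dot (S' \o S) (T \o T').
Proof. by move=> adj adj' x y /=; rewrite adj adj'. Qed.

Lemma is_adjoint_id : is_adjoint dot id id.
Proof. by []. Qed.

Lemma is_adjoint_uniq S S' T :
  is_adjoint dot S T -> is_adjoint dot S' T -> S = S'.
Proof.
move=> adj adj'; apply/funext => y; apply/eqP; rewrite -subr_eq0 -(dnorm_eq0 dot).
by rewrite linearBr /= -adj -adj' subrr.
Qed.

(** By Cauchy-Schwarz, |S y|^2 = dot (T (S y)) y is at most M |S y| |y|; then divide by |S y|. *)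
Lemma norm_bound_adjoint S T M :
  is_adjoint dot S T -> norm_bound T M -> norm_bound S M.
Proof.
move=> adj TM y; have [Sy0|Sy_gt0] := eqVneq (S y) 0.
  by rewrite Sy0 normr0 (le_trans _ (TM y)).
have {}Sy_gt0 : 0 < `|S y| by rewrite normr_gt0.
rewrite -(ler_pM2r Sy_gt0) -expr2 hdot -adj mulrAC.
have dot_ge0 : 0 <= dot (T (S y)) y by rewrite adj -hdot exprn_ge0.
rewrite -(ger0_norm dot_ge0); apply: (le_trans (dot_normM _ _)).
by rewrite ler_wpM2r.
Qed.

End Adjoints.

(** * Norm closures of *-algebras of operators *)

Section NormClosure.
Local Open Scope classical_set_scope.

Variables (R : realType) (H : completeNormedModType R[i]).
Variables (dot : {dot H for conjC}) (hdot : hilbert_dot dot).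
Implicit Types (S T : H -> H) (x y : H).

Lemma norm_bound_le T M N : M <= N -> norm_bound T M -> norm_bound T N.
Proof. by move=> le_MN TM x; apply: le_trans (TM x) _; rewrite ler_wpM2r. Qed.

Lemma cstar_bounded_op : cstar_subalgebra dot (@bounded_op R H).
Proof.
split=> //.
- exact: bounded_op0.
- exact: bounded_opD.
- exact: bounded_opZ.
- exact: bounded_op_comp.
- by move=> T [].
Qed.

Lemma sub_norm_closure (A : set (H -> H)) :
  A `<=` @bounded_op R H -> A `<=` norm_closure A.
Proof.
move=> A_bnd T AT; split=> [|e e_gt0]; first exact: A_bnd.
by exists T => // x; rewrite subrr normr0 mulr_ge0 // ltW.
Qed.

Variable A : set (H -> H).
Hypothesis A_bounded : A `<=` @bounded_op R H.
Hypothesis A0 : A 0.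
Hypothesis AD : forall S T, A S -> A T -> A (S + T).
Hypothesis AZ : forall (a : R[i]) T, A T -> A (a *: T).
Hypothesis AM : forall S T, A S -> A T -> A (S \o T).
Hypothesis A_adjoint : forall T, A T -> exists2 S, A S & is_adjoint dot S T.

Lemma cstar_norm_closure : cstar_subalgebra dot (norm_closure A).
Proof.
split.
- by move=> T [].
- exact: sub_norm_closure.
- move=> S T [bS clS] [bT clT]; split; first exact: bounded_opD.
  move=> e e_gt0; have e2_gt0 : 0 < e / 2 by rewrite divr_gt0.
  have [S' AS' SS'] := clS _ e2_gt0; have [T' AT' TT'] := clT _ e2_gt0.
  exists (S' + T'); first exact: AD.
  by rewrite opprD addrACA [e]splitr; apply: norm_boundD.
- move=> a T [bT clT]; split; first exact: bounded_opZ.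
  move=> e e_gt0; have a1_gt0 : 0 < `|a| + 1 by rewrite ltr_wpDl.
  have [|T' AT' TT'] := clT (e / (`|a| + 1)); first by rewrite divr_gt0.
  exists (a *: T'); first exact: AZ.
  rewrite -scalerBr; apply: norm_bound_le (norm_boundZ a TT').
  by rewrite mulrCA ler_piMr ?ltW // ltr_pdivrMr // mul1r ltrDl.
- move=> S T [bS clS] [bT clT]; split; first exact: bounded_op_comp.
  move=> e e_gt0; have e2_gt0 : 0 < e / 2 by rewrite divr_gt0.
  have /bounded_opP[_ [M M_ge0 TM]] := bT.
  have M1_gt0 : 0 < M + 1 by rewrite ltr_wpDl.
  (* [S'] is chosen before [T'], because the tolerance for [T'] involves the bound N of [S'].
     Dividing by M + 1 and N + 1 covers bounds equal to 0. *)
  have [|S' AS' SS'] := clS (e / 2 / (M + 1)); first by rewrite divr_gt0.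
  have /bounded_opP[S'_lin [N N_ge0 S'N]] := A_bounded AS'.
  have N1_gt0 : 0 < N + 1 by rewrite ltr_wpDl.
  have [|T' AT' TT'] := clT (e / 2 / (N + 1)); first by rewrite divr_gt0.
  exists (S' \o T'); first exact: AM.
  have -> : (S \o T) - (S' \o T') = ((S - S') \o T) + (S' \o (T - T')).
    apply/funext => x; rewrite !fctE /=.
    have := S'_lin (-1) (T' x) (T x).
    rewrite !scaleN1r [- T' x + _]addrC => ->.
    by rewrite [X in _ = _ + X]addrC addrA subrK.
  rewrite [e]splitr; apply: norm_boundD.
    apply: (@norm_bound_le _ (e / 2 / (M + 1) * M)).
      by rewrite mulrAC ler_pdivrMr // ler_wpM2l ?ltW // ltrDl.
    by apply: norm_bound_comp => //; rewrite divr_ge0 ?ltW.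
  apply: (@norm_bound_le _ (N * (e / 2 / (N + 1)))).
    by rewrite mulrCA ler_piMr ?ltW // ltr_pdivrMr // mul1r ltrDl.
  exact: norm_bound_comp.
- move=> S T [bT clT] bS adjST; split=> // e e_gt0.
  have [T' AT' TT'] := clT _ e_gt0; have [S' AS' adjS'T'] := A_adjoint AT'.
  exists S' => //; apply: norm_bound_adjoint TT' => //.
  rewrite -[- S']scaleN1r -[- T']scaleN1r; apply: is_adjointD => //.
  have := is_adjointZ (-1) adjS'T'; rewrite rmorphN rmorph1; exact.
- move=> T [bT clT]; split=> // e e_gt0.
  have e2_gt0 : 0 < e / 2 by rewrite divr_gt0.
  have [S [bS clS] TS] := clT _ e2_gt0; have [S' AS' SS'] := clS _ e2_gt0.
  by exists S' => //; rewrite -(subrKA S) [e]splitr; apply: norm_boundD.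
Qed.

End NormClosure.

(** * Towers of operators *)

Section OperatorAdjoints.

Variables (R : realType) (H : completeNormedModType R[i]).
Variable dot : {dot H for conjC}.
Variable nz : exists x : H, x != 0.
Local Notation op := (bop nz).
Implicit Types S T : op.

Definition badj S T := is_adjoint dot S T.

Definition bunitary T := exists S, [/\ badj S T, S * T = 1 & T * S = 1].

Lemma badj1 : badj 1 1.
Proof. exact: is_adjoint_id. Qed.

Lemma badjM S S' T T' : badj S T -> badj S' T' -> badj (S' * S) (T * T').
Proof. exact: is_adjoint_comp. Qed.

Lemma badjZ a S T : badj S T -> badj (a^*%R *: S) (a *: T).
Proof. exact: is_adjointZ. Qed.

Lemma badj_sum I r (P : pred I) (S T : I -> op) :
  (forall i, badj (S i) (T i)) ->
  badj (\sum_(i <- r | P i) S i) (\sum_(i <- r | P i) T i).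
Proof.
move=> adj; apply: (big_ind2 badj) => // [x y|S1 T1 S2 T2].
  by rewrite linear0l linear0r.
exact: is_adjointD.
Qed.

Lemma badj_sym S T : badj S T -> badj T S.
Proof. exact: is_adjoint_sym. Qed.

Lemma badjX S T k : badj S T -> badj (S ^+ k) (T ^+ k).
Proof.
move=> adj; elim: k => [|k IHk]; first by rewrite !expr0; apply: badj1.
by rewrite exprS exprSr; apply: badjM.
Qed.

Lemma bunitaryM S T : bunitary S -> bunitary T -> bunitary (S * T).
Proof.
move=> [S' [adjS S'S SS']] [T' [adjT T'T TT']]; exists (T' * S'); split.
- exact: badjM.
- by rewrite mulrA -(mulrA T') S'S mulr1.
- by rewrite mulrA -(mulrA S) TT' mulr1.
Qed.

Lemma bunitary_scalar (a : R[i]) : bunitary a%:A <-> `|a| = 1.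
Proof.
split=> [[S [adj Sa aS]]|a1]; last first.
  have aa : a * a^*%R = 1 by rewrite -normCK a1 expr1n.
  exists (a^*%R)%:A; split; first exact: badjZ badj1.
    by rewrite -scalerAl mul1r scalerA mulrC aa scale1r.
  by rewrite -scalerAl mul1r scalerA aa scale1r.
have [x x_neq0] := nz.
have : dot ((a%:A : op) x) ((a%:A : op) x) = dot x x.
  by rewrite adj -[X in dot x X]/((S * a%:A) x) Sa.
rewrite -![_ x]/(a *: x) dnormZ -[RHS]mul1r => /(mulIf _).
rewrite dnorm_eq0 x_neq0 => /(_ isT)/eqP.
by rewrite sqrf_eq1 => /orP[/eqP //|/eqP a_neg]; have := normr_ge0 a; rewrite a_neg ler0N1.
Qed.

(** The adjoint of T^k is its inverse, which is T^(p - k) because T^p = 1. *)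
Lemma badj_unitaryX T p k : bunitary T -> T ^+ p = 1 -> (k <= p)%N ->
  badj (T ^+ (p - k)) (T ^+ k).
Proof.
move=> [S [adj ST TS]] Tp le_kp.
suff <- : S ^+ k = T ^+ (p - k) by apply: badjX.
have STk : S ^+ k * T ^+ k = 1.
  by rewrite -exprMn_comm ?ST ?expr1n // /GRing.comm ST TS.
by rewrite -[RHS]mul1r -STk -mulrA -exprD subnKC // Tp mulr1.
Qed.

Lemma badj_weyl_unit (V W : op) p i j : bunitary V -> bunitary W ->
  V ^+ p = 1 -> W ^+ p = 1 -> (i <= p)%N -> (j <= p)%N ->
  badj (weyl_unit p V W j i) (weyl_unit p V W i j).
Proof.
move=> uV uW Vp Wp le_ip le_jp.
have adjP : badj (weyl_proj p V) (weyl_proj p V).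
  (* One copy of the average is shifted to the exponents 1, ..., p; order reversal then matches p -
     k with k, which are the exponents of mutually adjoint powers. *)
  rewrite {1}/weyl_proj -(sum_weyl_shift Vp) (reindex_inj rev_ord_inj) /=.
  have -> : p%:R^-1 = (p%:R^-1 : R[i])^*%R by rewrite geC0_conj ?invr_ge0 ?ler0n.
  apply: badjZ; apply: badj_sum => k.
  by rewrite -subSn // subSS; apply: badj_unitaryX => //; apply: ltnW.
have -> : weyl_unit p V W j i = W ^+ j * (weyl_proj p V * W ^+ (p - i)).
  by rewrite mulrA.
apply: badjM; last by apply/badj_sym/badj_unitaryX.
by apply: badjM => //; apply: badj_unitaryX.
Qed.

End OperatorAdjoints.

(** * The *-algebra of a tower of matrix units and its closure *)

Section TowerOfOperators.

Local Open Scope classical_set_scope.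

Variables (R : realType) (H : completeNormedModType R[i]).
Variables (dot : {dot H for conjC}) (hdot : hilbert_dot dot).
Variables (nz : exists x : H, x != 0) (q : nat).
Variable E : nat -> 'I_q -> 'I_q -> bop nz.
Hypothesis EM : forall n i j k l, E n i j * E n k l = if j == k then E n i l else 0.
Hypothesis E1 : forall n, \sum_i E n i i = 1.
Hypothesis EC : forall m n i j k l, (m < n)%N -> GRing.comm (E m i j) (E n k l).
Hypothesis E_adj : forall n i j, badj dot (E n j i) (E n i j).

(** Transposition exchanges the block indices. Taking adjoints reverses each product of a block and
    a unit, and the two factors commute. *)
Lemma badj_matrix_tower n (a : 'M[R[i]]_(tensor_dim q n)) :
  badj dot (matrix_tower E (map_mx conjC a^T)) (matrix_tower E a).
Proof.
elim: n a => [|n IHn] a /=; first by rewrite !mxE; apply/badjZ/badj1.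
rewrite {1}/matrix_unit_ext exchange_big.
apply: badj_sum => i; apply: badj_sum => j /=.
rewrite (matrix_tower_unit_comm EC).
have -> : tens_block (map_mx conjC a^T) j i = map_mx conjC (tens_block a i j)^T.
  by apply/matrixP => k l; rewrite !mxE.
by apply: badjM; [apply: IHn|apply: E_adj].
Qed.

Lemma matrix_tower_star_embedding n :
  star_embedding dot (fun a : 'M[R[i]]_(tensor_dim q n) => matrix_tower E a : H -> H).
Proof.
split.
- by move=> k a b; rewrite matrix_tower_linear.
- by move=> a b; rewrite (matrix_towerM EM EC).
- exact: badj_matrix_tower.
- move=> a b /bop_ext ab; apply/eqP; rewrite -subr_eq0; apply/eqP.
  by apply: (matrix_tower_inj EM E1 EC); rewrite linearB /= ab subrr.
Qed.

Definition tower_algebra : set (H -> H) :=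
  \bigcup_n range (fun a : 'M[R[i]]_(tensor_dim q n) => matrix_tower E a : H -> H).

Lemma tower_algebraP n T : tower_range E n T -> tower_algebra T.
Proof. by case=> a ->; exists n => //; exists a. Qed.

Lemma tower_algebra_bounded : tower_algebra `<=` @bounded_op R H.
Proof. by move=> _ [n _ [a _ <-]]; apply: bopP. Qed.

Lemma tower_range_join m n S T : tower_range E m S -> tower_range E n T ->
  exists2 k, tower_range E k S & tower_range E k T.
Proof.
by exists (maxn m n); [apply: (tower_range_le E1 (leq_maxl m n))|
  apply: (tower_range_le E1 (leq_maxr m n))].
Qed.

(** The levels are nested, so two elements of the union lie in a common level, where sums and
    products are formed. *)
Lemma cstar_tower_closure : cstar_subalgebra dot (norm_closure tower_algebra).
Proof.
apply: (cstar_norm_closure hdot); first exact: tower_algebra_bounded.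
- by exists 0 => //; exists 0 => //; rewrite linear0.
- move=> _ _ [m _ [a _ <-]] [n _ [b _ <-]].
  have [||k ma nb] := @tower_range_join m n (matrix_tower E a) (matrix_tower E b);
    [by exists a|by exists b|].
  apply: (@tower_algebraP k (matrix_tower E a + matrix_tower E b)).
  by have [_ _ rD _] := tower_range_subalg EM E1 EC k; apply: rD.
- by move=> a _ [n _ [b _ <-]]; exists n => //; exists (a *: b) => //; rewrite linearZ.
- move=> _ _ [m _ [a _ <-]] [n _ [b _ <-]].
  have [||k ma nb] := @tower_range_join m n (matrix_tower E a) (matrix_tower E b);
    [by exists a|by exists b|].
  apply: (@tower_algebraP k (matrix_tower E a * matrix_tower E b)).
  by have [_ _ _ rM] := tower_range_subalg EM E1 EC k; apply: rM.
- move=> _ [n _ [a _ <-]]; exists (matrix_tower E (map_mx conjC a^T)).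
    by exists n => //; exists (map_mx conjC a^T).
  exact: badj_matrix_tower.
Qed.

End TowerOfOperators.

(** * Commutation relations and monomials *)

Section RootOfUnity.

Variable R : realType.

(** De Moivre's formula. *)
Lemma zetaX p k : zeta R p ^+ k =
  cos (2 * pi / p%:R *+ k) +i* sin (2 * pi / p%:R *+ k).
Proof.
elim: k => [|k IHk]; first by rewrite !mulr0n cos0 sin0 expr0.
rewrite exprS IHk /zeta (mulrS (2 * pi / p%:R)) cosD sinD; simpc.
by rewrite [sin _ * cos _ + _]addrC.
Qed.

(** The order divides the prime p, so it is 1 or p. Order 1 would give cos (2 pi / p) = 1, but cos
    decreases strictly on [0, pi] and 0 < 2 pi / p <= pi. *)
Lemma zeta_prim p : prime p -> p.-primitive_root (zeta R p).
Proof.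
move=> p_prime; have p_gt0 := prime_gt0 p_prime; have p_gt1 := prime_gt1 p_prime.
have zp1 : zeta R p ^+ p = 1.
  rewrite zetaX -mulr_natr divfK ?pnatr_eq0 ?gtn_eqF //.
  by rewrite mulr_natl cos2pi sin2pi.
have [m m_prim m_dvd] := prim_order_exists p_gt0 zp1.
case/primeP: p_prime => _ /(_ m m_dvd)/orP[/eqP m1|/eqP mp]; last by rewrite -{1}mp.
move: m_prim; rewrite m1 => /prim_expr_order; rewrite expr1 => /(congr1 (@complex.Re R)) /= cos1.
have : cos (2 * pi / p%:R) < cos (0 : R).
  have p2 : (2 : R) <= p%:R by rewrite ler_nat.
  have p0 : (0 : R) < p%:R by rewrite ltr0n.
  have q_gt0 : 0 < 2 * pi / p%:R :> R by rewrite divr_gt0 ?mulr_gt0 ?pi_gt0.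
  have q_le : 2 * pi / p%:R <= pi :> R.
    by rewrite ler_pdivrMr // mulrC ler_wpM2l // pi_ge0.
  by rewrite ltr_cos ?in_itv /= ?lexx ?pi_ge0 // (ltW q_gt0).
by rewrite cos1 cos0 ltxx.
Qed.

Lemma zeta2 : zeta R 2 = -1.
Proof.
rewrite /zeta mulrAC divff ?pnatr_eq0 // mul1r cospi sinpi.
by apply/eqP; rewrite eq_complex /= oppr0 !eqxx.
Qed.

End RootOfUnity.

(** * The alternating form on finitely supported sequences *)

Section CommutationForm.

Variables (p : nat) (c : nat -> nat -> 'F_p).
Local Notation V := {poly 'F_p}.
Implicit Types x y : V.

(** Coefficients beyond the size are 0. A common summation range is what makes linearity a termwise
    identity. *)
Lemma omega_widen m n x y : (size y <= m)%N -> (size x <= n)%N ->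
  omega c x y = \sum_(i < m) \sum_(j < n) c i j * x`_j * y`_i.
Proof.
move=> le_ym le_xn.
rewrite /omega (big_ord_widen _ (fun i => \sum_(j < size x) c i j * x`_j * y`_i) le_ym).
rewrite big_mkcond; apply: eq_bigr => i _; case: ltnP => [_|le_yi].
  rewrite (big_ord_widen _ (fun j => c i j * x`_j * y`_i) le_xn) big_mkcond /=.
  by apply: eq_bigr => j _; case: ltnP => // le_xj; rewrite (nth_default 0 le_xj) mulr0 mul0r.
by rewrite big1 // => j _; rewrite (nth_default 0 le_yi) mulr0.
Qed.

Lemma omega_scalar y : scalar ((omega c)^~ y).
Proof.
move=> a x x'; pose n := maxn (size x) (size x').
have le_xn : (size x <= n)%N by apply: leq_maxl.
have le_x'n : (size x' <= n)%N by apply: leq_maxr.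
rewrite !(@omega_widen (size y) n) //; last first.
  by rewrite (leq_trans (size_polyD _ _)) // geq_max le_x'n (leq_trans (size_scale_leq _ _)).
rewrite mulr_sumr -big_split; apply: eq_bigr => i _ /=.
rewrite mulr_sumr -big_split; apply: eq_bigr => j _ /=.
by rewrite coefD coefZ mulrDr !mulrDl !mulrA [c i j * a]mulrC.
Qed.

Lemma omega0l y : omega c 0 y = 0.
Proof. by rewrite (@omega_widen (size y) 0) ?size_poly0 // big1 // => i _; rewrite big_ord0. Qed.

Lemma omegaDl x x' y : omega c (x + x') y = omega c x y + omega c x' y.
Proof. by have := omega_scalar y 1 x x'; rewrite scale1r mul1r. Qed.

Lemma omegaXn i j : omega c 'X^j 'X^i = c i j.
Proof.
rewrite /omega !size_polyXn !big_ord_recr /= big1 => [|k _]; last first.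
  by rewrite big1 // => l _; rewrite !coefXn (ltn_eqF (ltn_ord k)) mulr0.
rewrite big1 => [|k _]; first by rewrite !add0r !coefXn !eqxx !mulr1.
by rewrite !coefXn (ltn_eqF (ltn_ord k)) mulr0 mul0r.
Qed.

Hypothesis c_skew : skew_symmetric_mx c.

Lemma omega_skew x y : omega c x y = - omega c y x.
Proof.
rewrite /omega exchange_big -sumrN; apply: eq_bigr => i _; rewrite -sumrN.
by apply: eq_bigr => j _; rewrite (c_skew j i).1 !mulNr mulrAC.
Qed.

Lemma omegaDr x y y' : omega c x (y + y') = omega c x y + omega c x y'.
Proof. by rewrite omega_skew omegaDl opprD -!omega_skew. Qed.

(** Cross terms cancel by skew-symmetry and the terms in a single 'X^i vanish by [c i i = 0]; this
    also covers characteristic 2. *)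
Lemma omega_alt x : omega c x x = 0.
Proof.
rewrite -[x]coefK poly_def.
apply: (big_ind (fun x => omega c x x = 0)) => [|y z y0 z0|i _].
- exact: omega0l.
- by rewrite omegaDl !omegaDr y0 z0 (omega_skew z) add0r addr0 subrr.
have := omega_scalar (x`_i *: 'X^i) x`_i 'X^i 0; rewrite addr0 omega0l addr0 => ->.
have := omega_scalar 'X^i x`_i 'X^i 0; rewrite addr0 omega0l addr0 => E.
by rewrite omega_skew E omegaXn (c_skew i i).2 !(mulr0, oppr0).
Qed.

End CommutationForm.

(** * Monomials in the unitaries *)

Section Monomials.

Variables (R : realType) (H : completeNormedModType R[i]).
Variable dot : {dot H for conjC}.
Variable nz : exists x : H, x != 0.
Local Notation op := (bop nz).
Variables (p : nat) (c : nat -> nat -> 'F_p) (U : nat -> op).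
Hypothesis p_prime : prime p.
Hypothesis U_unitary : forall k, bunitary dot (U k).
Hypothesis U_comm : forall i j, U i * U j = zeta R p ^+ (c i j : nat) *: (U j * U i).
Hypothesis U_irr : forall T : op,
  (forall k, GRing.comm T (U k)) -> exists a : R[i], T = a%:A.

Implicit Types (x y : {poly 'F_p}) (S T : op).
Local Notation w := (omega c).

(** The additive character of ['F_p] that sends 1 to zeta. *)
Definition zexp (a : 'F_p) : R[i] := zeta R p ^+ (a : nat).

Lemma zexpD a b : zexp (a + b) = zexp a * zexp b.
Proof.
rewrite /zexp -exprD /= [X in (_ %% X)%N](Fp_cast p_prime) expr_mod //.
exact/prim_expr_order/zeta_prim.
Qed.

Lemma zexp0 : zexp 0 = 1. Proof. by rewrite /zexp expr0. Qed.

Lemma zexp1 : zexp 1 = zeta R p. Proof. by rewrite /zexp expr1. Qed.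

Lemma zexp_inj0 a : zexp a = 1 -> a = 0.
Proof.
move/eqP; rewrite -(prim_order_dvd (zeta_prim R p_prime)) => p_dvd.
have lt_ap : (a < p)%N by rewrite -[X in (_ < X)%N](Fp_cast p_prime) ltn_ord.
by apply/val_inj/eqP => /=; apply: contraTT p_dvd; rewrite -lt0n => a_gt0; rewrite gtnNdvd.
Qed.

(** Exchanging [U i] and [U j] twice multiplies the non-zero operator [U i * U j] by zeta^(c i j + c
    j i), which must be 1; on the diagonal a single exchange suffices. The character [zexp] is
    faithful. *)
Lemma U_comm_skew : skew_symmetric_mx c.
Proof.
have UU_neq0 i j : U i * U j != 0.
  have [S [_ _ US]] := bunitaryM (U_unitary i) (U_unitary j).
  by apply: contra_eq_neq US => ->; rewrite mul0r eq_sym oner_neq0.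
have scaleUU a i j : U i * U j = a *: (U i * U j) -> a = 1.
  move=> /eqP; rewrite -[X in X == _]scale1r -subr_eq0 -scalerBl scaler_eq0.
  by rewrite (negPf (UU_neq0 i j)) orbF subr_eq0 => /eqP.
move=> i j; split; last exact/zexp_inj0/(scaleUU _ i i)/U_comm.
apply/eqP; rewrite -addr_eq0; apply/eqP/zexp_inj0.
by apply: (scaleUU _ i j); rewrite zexpD -scalerA -U_comm -U_comm.
Qed.

(* The unimodular multiples of words in the U_k; x only records modulo p how
   often each U_k occurs. *)
Inductive monomial : {poly 'F_p} -> op -> Prop :=
| monomial_scalar (a : R[i]) of `|a| = 1 : monomial 0 a%:A
| monomial_mulU x T k of monomial x T : monomial (x + 'X^k) (T * U k).

Lemma monomial1 : monomial 0 1.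
Proof. by have := @monomial_scalar 1; rewrite normr1 scale1r; apply. Qed.

Lemma monomial_U k : monomial 'X^k (U k).
Proof. by have := monomial_mulU k monomial1; rewrite add0r mul1r. Qed.

Lemma monomialZ a x T : `|a| = 1 -> monomial x T -> monomial x (a *: T).
Proof.
move=> a1; elim=> [b b1|{}x {}T k _ IH].
  by rewrite scalerA; apply: monomial_scalar; rewrite normrM a1 b1 mulr1.
by rewrite scalerAl; apply: monomial_mulU.
Qed.

Lemma monomialM x y S T : monomial x S -> monomial y T -> monomial (x + y) (S * T).
Proof.
move=> xS; elim=> [a a1|{}y {}T k _ IH].
  by rewrite addr0 -scalerAr mulr1; apply: monomialZ.
by rewrite addrA mulrA; apply: monomial_mulU.
Qed.

Lemma monomialX x T n : monomial x T -> monomial (x *+ n) (T ^+ n).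
Proof.
move=> xT; elim: n => [|n IHn]; first exact: monomial1.
by rewrite mulrS exprS; apply: monomialM.
Qed.

Lemma monomial_unitary x T : monomial x T -> bunitary dot T.
Proof.
elim=> [a /(bunitary_scalar dot) //|{}x {}T k _ uT]; exact: bunitaryM.
Qed.

(** The phase is multiplicative in each factor and the form is additive in each argument, so a
    double induction reduces this to [U_comm]. The order of [T] and [S] matches
    [omega c 'X^j 'X^i = c i j]. *)
Lemma monomial_comm x y S T : monomial x S -> monomial y T ->
  T * S = zexp (w x y) *: (S * T).
Proof.
have c_skew := U_comm_skew.
move=> xS yT; elim: xS => [a _|{}x {}S k _ IHS].
  by rewrite omega0l zexp0 scale1r -scalerAl -scalerAr mulr1 mul1r.
rewrite mulrA IHS omegaDl zexpD -scalerAl -!mulrA -scalerA; congr (_ *: _).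
rewrite scalerAr; congr (_ * _) => {S IHS}.
elim: yT => [a _|{}y {}T j _ IHT].
  rewrite (omega_skew c_skew) omega0l oppr0 zexp0 scale1r.
  by rewrite -scalerAl -scalerAr mulr1 mul1r.
rewrite (omegaDr c_skew) omegaXn zexpD -mulrA U_comm -scalerAr (mulrA T) IHT.
by rewrite -scalerAl scalerA mulrC mulrA.
Qed.

Lemma monomial_exists x : exists T, monomial x T.
Proof.
rewrite -[x]coefK poly_def.
apply: (big_ind (fun x => exists T, monomial x T)) => [|y z [S yS] [T zT]|i _].
- by exists 1; apply: monomial1.
- by exists (S * T); apply: monomialM.
move: x`_i => a; exists (U i ^+ (a : nat)); rewrite -[a]natr_Zp scaler_nat natr_Zp.
exact/monomialX/monomial_U.
Qed.

(* This is the only use of irreducibility. *)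
Lemma monomial_radical x T : monomial x T -> (forall y, w x y = 0) ->
  exists2 a : R[i], `|a| = 1 & T = a%:A.
Proof.
move=> xT x_rad; have [k|a Ta] := U_irr (T := T).
  by rewrite /GRing.comm (monomial_comm xT (monomial_U k)) x_rad zexp0 scale1r.
by exists a => //; apply/(bunitary_scalar dot); rewrite -Ta; apply: monomial_unitary xT.
Qed.

(** Multiplying [S] and [T] by a monomial of -y gives monomials of radical vectors, hence scalars;
    that unitary factor is then cancelled. *)
Lemma monomial_proportional x y S T : monomial x S -> monomial y T ->
  (forall z, w (x - y) z = 0) -> exists a : R[i], S = a *: T.
Proof.
move=> xS yT xy_rad; have [T' yT'] := monomial_exists (- y).
have [a _ ST'] := monomial_radical (monomialM xS yT') xy_rad.
have [|b b1 TT'] := monomial_radical (monomialM yT yT').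
  by move=> z; rewrite subrr omega0l.
have b_neq0 : b != 0 by rewrite -normr_eq0 b1 oner_neq0.
have [T'' [_ T''T' T'T'']] := monomial_unitary yT'.
exists (a / b); rewrite -[S]mulr1 -[T]mulr1 -T'T'' !mulrA ST' TT'.
by rewrite -!scalerAl mul1r scalerA divfK.
Qed.

(** T^p is a monomial of p x = 0, hence a unimodular scalar; [T] is divided by a p-th root of it. *)
Lemma monomial_normalize x : exists2 T, monomial x T & T ^+ p = 1.
Proof.
have [T xT] := monomial_exists x.
have p_gt0 := prime_gt0 p_prime.
have xp0 : x *+ p = 0.
  by rewrite -scaler_nat pchar_Fp_0 // scale0r.
have [|a a1 Tp] := monomial_radical (monomialX p xT).
  by move=> z; rewrite xp0 omega0l.
pose b := p.-root a.
have bp : b ^+ p = a by rewrite rootCK.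
have b_norm : `|b| = 1.
  by apply/eqP; rewrite -(pexpr_eq1 p_gt0) // -normrX bp a1.
have a_neq0 : a != 0 by rewrite -normr_eq0 a1 oner_neq0.
exists (b^-1 *: T); first by apply: monomialZ => //; rewrite normfV b_norm invr1.
by rewrite exprZn Tp exprVn bp scalerA mulVf // scale1r.
Qed.

End Monomials.

(** * The generated algebra *)

Section InfiniteTensorProduct.

Local Open Scope classical_set_scope.

Variables (R : realType) (H : completeNormedModType R[i]).
Variables (dot : {dot H for conjC}) (hdot : hilbert_dot dot).
Variable nz : exists x : H, x != 0.
Local Notation op := (bop nz).
Variables (p : nat) (c : nat -> nat -> 'F_p) (U : nat -> op).
Hypothesis p_prime : prime p.
Hypothesis U_unitary : forall k, bunitary dot (U k).
Hypothesis U_comm : forall i j, U i * U j = zeta R p ^+ (c i j : nat) *: (U j * U i).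
Hypothesis U_irr : forall T : op,
  (forall k, GRing.comm T (U k)) -> exists a : R[i], T = a%:A.
Hypothesis c_infinite_rank : infinite_rank c.

Implicit Types (x y : {poly 'F_p}) (S T : op).
Local Notation w := (omega c).
Local Notation mon := (monomial U).

Let G := cstar_generated dot (fun k => bop_fun (U k)).

(** All clauses pass to intersections; boundedness holds because the algebra of all bounded
    operators is one of those intersected. *)
Lemma cstar_generated_subalgebra (u : nat -> H -> H) :
  (forall k, bounded_op (u k)) -> cstar_subalgebra dot (cstar_generated dot u).
Proof.
move=> bu; split.
- move=> T; apply; split; first exact: cstar_bounded_op.
  by move=> _ [k _ <-]; apply: bu.
- by move=> A [/cstar_zero].
- by move=> S T GS GT A AG; apply: (cstar_add AG.1); [exact: GS|exact: GT].
- by move=> a T GT A AG; apply: (cstar_scale AG.1); exact: GT.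
- by move=> S T GS GT A AG; apply: (cstar_comp AG.1); [exact: GS|exact: GT].
- by move=> S T GT bS adj A AG; apply: (cstar_adjoint AG.1) adj => //; exact: GT.
- move=> T [bT clT] A AG; apply: (cstar_closed AG.1); split=> // e /clT[S GS ST].
  by exists S => //; apply: GS.
Qed.

Let G_sub : cstar_subalgebra dot G.
Proof. by apply: cstar_generated_subalgebra => k; apply: bopP. Qed.

Lemma generated_U k : G (U k).
Proof. by move=> A [_]; apply; exists k. Qed.

(** A C*-subalgebra in the sense of [cstar_subalgebra] need not contain the identity; here it is the
    product of the adjoint of [U 0] with [U 0]. *)
Lemma generated1 : G (1 : op).
Proof.
have [S [adj SU US]] := U_unitary 0; rewrite -SU; apply: (cstar_comp G_sub).
  by apply: (cstar_adjoint G_sub) adj; [exact: generated_U|exact: bopP].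
exact: generated_U.
Qed.

Lemma generatedZ a T : G T -> G (a *: T : op).
Proof. exact: (cstar_scale G_sub). Qed.

Lemma generatedM S T : G S -> G T -> G (S * T : op).
Proof. exact: (cstar_comp G_sub). Qed.

Lemma generated_sum I r (P : pred I) (F : I -> op) :
  (forall i, G (F i)) -> G (\sum_(i <- r | P i) F i : op).
Proof.
move=> GF; apply: (big_ind (fun T : op => G T)) => //.
  exact: (cstar_zero G_sub).
by move=> S T; apply: (cstar_add G_sub).
Qed.

Lemma generatedX T k : G T -> G (T ^+ k).
Proof.
move=> GT; elim: k => [|k IHk]; first by rewrite expr0; apply: generated1.
by rewrite exprS; apply: generatedM.
Qed.

Lemma generated_monomial x T : mon x T -> G T.
Proof.
elim=> [a _|{}x {}T k _ GT]; first by apply: generatedZ; apply: generated1.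
by apply: generatedM => //; apply: generated_U.
Qed.

(** The tower lies in [G] because its matrix units are polynomials in monomials. Conversely each
    [U k] lies in level k + 1 of the tower. *)
Lemma UHF_cstar_generated : UHF_type dot p G.
Proof.
have c_skew := U_comm_skew p_prime U_unitary U_comm.
have z_prim := zeta_prim R p_prime; have p_gt0 := prime_gt0 p_prime.
have pC_neq0 : p%:R != 0 :> R[i] by rewrite pnatr_eq0 -lt0n.
have Xspan x : exists n (a : 'I_n -> 'F_p), x = \sum_i a i *: 'X^i.
  by exists (size x), (fun i => x`_i); rewrite -{1}[x]coefK poly_def.
have [|u [u_hyp u_cover]] := symplectic_sequence (omega_scalar c)
  (omega_skew c_skew) (omega_alt c_skew) Xspan.
  move=> n; have [v v_free] := c_infinite_rank n.
  by exists v => a a_rad; apply: v_free; apply: a_rad.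
have normal := monomial_normalize p_prime U_unitary U_comm U_irr.
have normal1 x : exists T, mon x T /\ T ^+ p = 1 by have [T] := normal x; exists T.
(* [W n] represents e_n and [V n] represents f_n, so w e_n f_n = 1 becomes the Weyl relation
   below. *)
have [W /all_and2[W_mon Wp]] := choice (fun n => normal1 (u n).1).
have [V /all_and2[V_mon Vp]] := choice (fun n => normal1 (u n).2).
have monC := monomial_comm p_prime U_unitary U_comm.
have VW n : V n * W n = zeta R p *: (W n * V n).
  have [wef _ _] := u_hyp n.+1 n n (ltnSn n) (ltnSn n).
  by rewrite (monC _ _ _ _ (W_mon n) (V_mon n)) wef eqxx zexp1.
pose E n (i j : 'I_p) := weyl_unit p (V n) (W n) i j.
have EM n i j k l : E n i j * E n k l = if j == k then E n i l else 0.
  exact: (weyl_unitM _ z_prim).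
have E1 n : \sum_i E n i i = 1 by apply: (sum_weyl_unit _ z_prim).
have EC m n i j k l : (m < n)%N -> GRing.comm (E m i j) (E n k l).
  move=> lt_mn.
  have comm0 x y S T : mon x S -> mon y T -> w x y = 0 -> GRing.comm S T.
    by move=> xS yT w0; rewrite /GRing.comm (monC _ _ _ _ xS yT) w0 zexp0 scale1r.
  (* Distinct pairs are orthogonal for the form, so all four combinations of [V] and [W] with
     indices m and n commute. *)
  have [w12 w11 w22] := u_hyp n.+1 m n (ltnW (lt_mn : (m.+1 < n.+1)%N)) (ltnSn n).
  have [w21 _ _] := u_hyp n.+1 n m (ltnSn n) (ltnW (lt_mn : (m.+1 < n.+1)%N)).
  rewrite (gtn_eqF lt_mn) in w21; rewrite (ltn_eqF lt_mn) in w12.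
  have {}w21 : w (u m).2 (u n).1 = 0 by rewrite (omega_skew c_skew) w21 oppr0.
  by apply: comm_weyl_unit; apply/commr_sym/comm_weyl_unit; apply/commr_sym;
    [apply: (comm0 _ _ _ _ (V_mon m) (V_mon n))|apply: (comm0 _ _ _ _ (W_mon m) (V_mon n))
    |apply: (comm0 _ _ _ _ (V_mon m) (W_mon n))|apply: (comm0 _ _ _ _ (W_mon m) (W_mon n))].
have GE n i j : G (E n i j).
  apply: generatedM; last by apply: generatedX; apply: generated_monomial (W_mon _).
  apply: generatedM; first by apply: generatedX; apply: generated_monomial (W_mon _).
  apply: generatedZ; apply: generated_sum => k.
  by apply: generatedX; apply: generated_monomial (V_mon _).
have uni x T : mon x T -> bunitary dot T by apply: monomial_unitary.
have Eadj n i j : badj dot (E n j i) (E n i j).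
  by apply: badj_weyl_unit; rewrite ?(ltnW (ltn_ord _)) //; apply: uni.
have G_tower n (a : 'M[R[i]]_(tensor_dim p n)) : G (matrix_tower E a).
  elim: n a => [|n IHn] a; first by apply: generatedZ; apply: generated1.
  by apply: generated_sum => i; apply: generated_sum => j; apply: generatedM.
have rangeV n : tower_range E n.+1 (V n).
  have [b ->] := weyl_unit_span_diag pC_neq0 z_prim (Vp n) (Wp n) (VW n).
  exact: tower_range_unit EM E1 EC n b.
have rangeW n : tower_range E n.+1 (W n).
  have [b ->] := weyl_unit_span_shift pC_neq0 z_prim (Wp n) (VW n).
  exact: tower_range_unit EM E1 EC n b.
pose Q n x := exists2 T, mon x T & tower_range E n T.
split=> //; exists (fun n (a : tensor_power R p n) => matrix_tower E a : H -> H).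
split=> [n|n a|//|]; first exact: matrix_tower_star_embedding.
  by rewrite /tensor_incl (matrix_tower_incl E1).
(* The closure of the tower is a C*-subalgebra, so it is enough that it contains each [U k]. *)
apply: smallest_sub; first exact: cstar_tower_closure.
move=> _ [k _ <-]; apply: sub_norm_closure; first exact: tower_algebra_bounded.
(* The projection of 'X^k on the first k + 1 pairs is represented by a product of powers of [V i]
   and [W i] with i <= k, all of which lie in level k + 1. *)
have [T xT nT] : Q k.+1 (hyperbolic_part w u k.+1 'X^k).
  have [r1 _ _ rM] := tower_range_subalg EM E1 EC k.+1.
  have QD x y : Q k.+1 x -> Q k.+1 y -> Q k.+1 (x + y).
    by move=> [S xS rS] [T yT rT]; exists (S * T); [apply: monomialM|apply: rM].
  have QZ (a : 'F_p) x : Q k.+1 x -> Q k.+1 (a *: x).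
    move=> [T xT rT]; rewrite -[a]natr_Zp scaler_nat.
    elim: (a : nat) => [|m [S xS rS]]; first by exists 1 => //; apply: monomial1.
    by rewrite mulrS; exists (T * S); [apply: monomialM|apply: rM].
  apply: (big_ind (Q k.+1)) => [||i _]; [|exact: QD|].
    by exists 1 => //; apply: monomial1.
  rewrite -scaleN1r; apply: (QD); first apply: (QZ).
    exists (W i); [exact: W_mon|exact: tower_range_le (ltn_ord i) (rangeW i)].
  do 2![apply: (QZ)].
  exists (V i); [exact: V_mon|exact: tower_range_le (ltn_ord i) (rangeV i)].
(* 'X^k differs from this projection by a radical vector, so [U k] is a scalar multiple of [T]. *)
have [|a ->] := monomial_proportional p_prime U_unitary U_comm U_irr (monomial_U p U k) xT.
  by move=> z; apply: u_cover.
apply: (tower_algebraP (n := k.+1)).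
by have [_ rZ _ _] := tower_range_subalg EM E1 EC k.+1; apply: rZ.
Qed.

End InfiniteTensorProduct.

(** * Transfer to unbundled operators and the case of spin systems *)

Lemma cstar_generated_UHF (R : realType) (H : completeNormedModType R[i])
    (dot : {dot H for conjC}) (p : nat) (c : nat -> nat -> 'F_p) (U : nat -> H -> H) :
  hilbert_dot dot -> prime p -> infinite_rank c -> irreducible_seq dot U ->
  (forall k, unitary_op dot (U k)) ->
  (forall i j, U i \o U j = zeta R p ^+ (c i j : nat) *: (U j \o U i)) ->
  UHF_type dot p (cstar_generated dot U).
Proof.
move=> hdot p_prime c_rank [nz irr] U_unitary U_comm.
pose B k := bop_of nz (U_unitary k).1.
have B_unitary k : bunitary dot (B k).
  have [_ [S [bS adj SU US]]] := U_unitary k.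
  by exists (bop_of nz bS); split=> //; apply: bop_ext.
apply: (@UHF_cstar_generated _ _ _ hdot nz p c B) => // [i j|T T_comm].
  by apply: bop_ext; apply: U_comm.
have [|k S bS adj|a Ta] := irr T (bopP T).
- by move=> k; have /(congr1 (@bop_fun _ _ nz)) := T_comm k.
- have [S' [adj' S'U US']] := B_unitary k.
  (* The adjoint of a unitary is unique and equals its inverse, so whatever commutes with [U k]
     commutes with its adjoint too. *)
  rewrite (is_adjoint_uniq adj adj').
  have : T * S' = S' * T.
    by rewrite -[RHS]mulr1 -US' !mulrA -(mulrA S') T_comm mulrA S'U mul1r.
  by move/(congr1 (@bop_fun _ _ nz)).
- by exists a; apply: bop_ext.
Qed.

Theorem mainTheorem4 (R : realType) (H : completeNormedModType R[i])
    (dot : {dot H for conjC}) (hdot : hilbert_dot dot) :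
  (forall (p : nat) (c : nat -> nat -> 'F_p) (U : nat -> H -> H),
     prime p ->
     skew_symmetric_mx c ->
     infinite_rank c ->
     irreducible_seq dot U ->
     (forall k, unitary_op dot (U k)) ->
     (forall k, iter p (U k) =1 id) ->
     (forall i j, U i \o U j = zeta R p ^+ (c i j : nat) *: (U j \o U i)) ->
     UHF_type dot p (cstar_generated dot U))
  /\
  (forall (c : nat -> nat -> 'F_2) (U : nat -> H -> H),
     spin_system dot c U ->
     irreducible_seq dot U ->
     infinite_rank c ->
     CAR_algebra dot (cstar_generated dot U)).
Proof.
split=> [p c U p_prime _ c_rank irr U_unitary _ U_comm|c U [U_unitary _ U_comm] irr c_rank].
  exact: cstar_generated_UHF U_comm.
(* A spin system is the case p = 2, where zeta = -1. *)
apply: cstar_generated_UHF c_rank irr U_unitary _ => // i j.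
by rewrite zeta2; apply: U_comm.
Qed.
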